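(* Let $G=(V,E)$ be a computation graph with $n=|V|$ vertices, evaluated in parallel on $p$ processors, each with a private fast memory of size $M$. Let $\lambda_1(\tilde L)\le\dots\le\lambda_n(\tilde L)$ be the eigenvalues of $\tilde L$ in increasing order. Then for every positive integer $k$, in any such parallel evaluation at least one processor incurs a number of I/Os $J^*_G$ satisfying $$J^*_G \;\geq\; \left\lfloor\frac{n}{kp}\right\rfloor \sum_{i=1}^k \lambda_i(\tilde L) \;-\; 2kM.$$
   Context: A computation graph is a finite directed acyclic graph $G=(V,E)$. Each vertex is an operation producing a single element, and an edge $(u,v)$ means the result of $u$ is an operand of $v$. Parallel execution model: there are $p$ processors, each with its own fast memory holding at most $M$ elements, together with unbounded slow memory. Every vertex is evaluated exactly once (no recomputation) by exactly one processor, respecting the dependencies of $G$. No assumption is made on how the work is distributed among processors. To evaluate a vertex, all its operands must be in the evaluating processor's fast memory. A value that is evicted while still needed must first be written out. The I/O of a processor counts each element it communicates with slow memory or with another processor. As in the sequential non-trivial I/O convention, inputs can be placed directly into fast memory and outputs reported at no cost. $\tilde L=\tilde D-\tilde A$ is the Laplacian of the weighted undirected graph $\tilde G$ on $V$. For each directed edge $(u,v)\in E$, $\tilde G$ contains the undirected edge $\{u,v\}$ with weight $1/d_{out}(u)$, where $d_{out}$ is out-degree in $G$. *)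

(* Defs.v *)
From HB Require Import structures.
From mathcomp Require Import all_boot all_order all_algebra.
From mathcomp Require Import reals.
Set Implicit Arguments. Unset Strict Implicit. Unset Printing Implicit Defensive.
Import Order.TTheory GRing.Theory Num.Theory.
Local Open Scope ring_scope.

Definition dag (n : nat) (E : rel 'I_n) : bool :=
  [forall x : 'I_n, ~~ [exists y : 'I_n, E x y && connect E y x]].

Definition dout (n : nat) (E : rel 'I_n) (u : 'I_n) : nat := #|[set v | E u v]|.

(** Weighted adjacency of tilde G: each directed edge (u,v) gives the undirected
    edge {u,v} with weight 1/d_out(u). *)
Definition wadj (R : numFieldType) (n : nat) (E : rel 'I_n) : 'M[R]_n :=
  \matrix_(u, v) ((E u v)%:R / (dout E u)%:R + (E v u)%:R / (dout E v)%:R).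

Definition laplacian (R : numFieldType) (n : nat) (E : rel 'I_n) : 'M[R]_n :=
  diag_mx (\row_u \sum_v wadj R E u v) - wadj R E.

Inductive move (n p : nat) : Type :=
  | PCompute of 'I_p & 'I_n
  | PLoad of 'I_p & 'I_n
  | PStore of 'I_p & 'I_n
  | PSend of 'I_p & 'I_p & 'I_n
  | PEvict of 'I_p & 'I_n.

Record pstate (n p : nat) := PState {
  fast : 'I_p -> {set 'I_n};
  slow : {set 'I_n};
  evaluated : {set 'I_n}
}.

Definition init_state (n p : nat) : pstate n p :=
  PState (fun _ => set0) set0 set0.

Definition upd (n p : nat) (f : 'I_p -> {set 'I_n}) (q : 'I_p) (A : {set 'I_n}) :=
  fun r => if r == q then A else f r.

Definition move_ok (n p : nat) (E : rel 'I_n) (M : nat) (s : pstate n p)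
    (m : move n p) : bool :=
  match m with
  | PCompute q v => [&& v \notin evaluated s,
                      [forall u, E u v ==> (u \in fast s q)] &
                      #|v |: fast s q| <= M]%N
  | PLoad q v => (v \in slow s) && (#|v |: fast s q| <= M)%N
  | PStore q v => v \in fast s q
  | PSend q q' v => [&& v \in fast s q, q != q' & #|v |: fast s q'| <= M]%N
  | PEvict q v => v \in fast s q
  end.

Definition move_eff (n p : nat) (s : pstate n p) (m : move n p) : pstate n p :=
  match m with
  | PCompute q v => PState (upd (fast s) q (v |: fast s q)) (slow s) (v |: evaluated s)
  | PLoad q v => PState (upd (fast s) q (v |: fast s q)) (slow s) (evaluated s)
  | PStore q v => PState (fast s) (v |: slow s) (evaluated s)
  | PSend q q' v => PState (upd (fast s) q' (v |: fast s q')) (slow s) (evaluated s)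
  | PEvict q v => PState (upd (fast s) q (fast s q :\ v)) (slow s) (evaluated s)
  end.

Fixpoint valid_run (n p : nat) (E : rel 'I_n) (M : nat) (s : pstate n p)
    (ms : seq (move n p)) : Prop :=
  match ms with
  | [::] => True
  | m :: ms' => move_ok E M s m /\ valid_run E M (move_eff s m) ms'
  end.

(** A parallel evaluation of G on p processors with fast memories of size M:
    a valid run from the empty state after which every vertex has been
    evaluated (each exactly once, enforced by [move_ok]). *)
Definition parallel_evaluation (n p : nat) (E : rel 'I_n) (M : nat)
    (ms : seq (move n p)) : Prop :=
  valid_run E M (init_state n p) ms /\
  evaluated (foldl (@move_eff n p) (init_state n p) ms) = setT.

Definition move_io (n p : nat) (r : 'I_p) (m : move n p) : nat :=
  match m with
  | PLoad q _ | PStore q _ => (q == r)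
  | PSend q q' _ => (q == r) + (q' == r)
  | _ => 0
  end.

Definition io (n p : nat) (r : 'I_p) (ms : seq (move n p)) : nat :=
  \sum_(m <- ms) move_io r m.

(* Main.v *)
(** Some processor [q] evaluates at least [n / p] vertices.  Cut the run into [k]
    time segments in each of which [q] evaluates exactly [b = n %/ (k * p)]
    vertices, forming disjoint sets [S_1, ..., S_k].  An operand of [S_j] from
    outside [S_j] was in the fast memory of [q] when segment [j] began or was
    received during it; a vertex of [S_j] used outside [S_j] is in that memory when
    the segment ends or was sent out during it.  As each vertex has total outgoing
    weight at most 1, the weighted cut of [S_j] is thus at most the I/O of [q] in
    segment [j] plus [2 * M].  On the other hand that cut is the quadratic form of
    the Laplacian at the indicator of [S_j], and by Ky Fan's inequality for the
    normalised indicators the sum of the cuts divided by [b] is at least the sum of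
    the [k] smallest eigenvalues. *)
Require Import Defs.
From HB Require Import structures.
From mathcomp Require Import all_boot all_order all_algebra.
From mathcomp Require Import reals complex ring.
Set Implicit Arguments. Unset Strict Implicit. Unset Printing Implicit Defensive.
Import Order.TTheory GRing.Theory Num.Theory.

Local Open Scope nat_scope.

(** * Runs of the machine and the movement of values *)

Section Runs.
Variables (n p : nat) (E : rel 'I_n) (M : nat).
Implicit Types (s : pstate n p) (m : move n p) (ms : seq (move n p)).
Implicit Types (q r : 'I_p) (u v : 'I_n).

Definition run s ms := foldl (@move_eff n p) s ms.

Definition computes ms : seq ('I_p * 'I_n) :=
  pmap (fun m => if m is PCompute q v then Some (q, v) else None) ms.

Definition computed_by q ms : seq 'I_n :=
  [seq x.2 | x <- computes ms & x.1 == q].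

(** Kept as a list with repetitions: every transfer counts, so the sizes of [ins] and [outs] add up
    to [io] exactly. *)
Definition ins q ms : seq 'I_n :=
  pmap (fun m => match m with
    | PLoad q' v => if q' == q then Some v else None
    | PSend _ q' v => if q' == q then Some v else None
    | _ => None end) ms.

Definition outs q ms : seq 'I_n :=
  pmap (fun m => match m with
    | PStore q' v => if q' == q then Some v else None
    | PSend q' _ v => if q' == q then Some v else None
    | _ => None end) ms.

(** Invariant of runs from the empty state. It makes a vertex not yet evaluated absent from every
    memory, hence confined to any processor. *)
Definition coherent s :=
  [/\ forall r, #|fast s r| <= M,
      forall r, fast s r \subset evaluated s &
      slow s \subset evaluated s].

(* A value that exists only in the memory of [q] can reach another place only
   through [outs q]. *)
Definition confined q u s :=
  u \notin slow s /\ forall r, u \in fast s r -> r = q.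

Lemma valid_run_cat s ms1 ms2 :
  valid_run E M s (ms1 ++ ms2) <->
  valid_run E M s ms1 /\ valid_run E M (run s ms1) ms2.
Proof.
elim: ms1 s => [|m ms1 IH] s /=; first by split=> [|[]].
by rewrite IH; split=> [[? []]|[[]]].
Qed.

Lemma computes_cat ms1 ms2 : computes (ms1 ++ ms2) = computes ms1 ++ computes ms2.
Proof. exact: pmap_cat. Qed.

Lemma computed_by_cat q ms1 ms2 :
  computed_by q (ms1 ++ ms2) = computed_by q ms1 ++ computed_by q ms2.
Proof. by rewrite /computed_by computes_cat filter_cat map_cat. Qed.

Lemma mem_computed_by q v ms : (v \in computed_by q ms) = ((q, v) \in computes ms).
Proof.
apply/mapP/idP => [[[q' v']]|qv]; last by exists (q, v); rewrite // mem_filter /= eqxx.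
by rewrite mem_filter /= => /andP[/eqP-> ?] ->.
Qed.

Lemma io_cat q ms1 ms2 : io q (ms1 ++ ms2) = io q ms1 + io q ms2.
Proof. by rewrite /io big_cat. Qed.

Lemma io_ins_outs q ms : io q ms = size (ins q ms) + size (outs q ms).
Proof.
rewrite /io; elim: ms => [|m ms IH]; first by rewrite big_nil.
rewrite big_cons IH; case: m => [r v|r v|r v|r r' v|r v] //=.
- by case: (r == q).
- by case: (r == q) => //=; rewrite addnS.
- by case: (r == q); case: (r' == q) => /=; rewrite ?addnS.
Qed.

Lemma coherent_init : coherent (init_state n p).
Proof. by split=> [r|r|]; rewrite /= ?cards0 ?sub0set. Qed.

Lemma coherent_move s m : move_ok E M s m -> coherent s -> coherent (move_eff s m).
Proof.
move=> ok [cM cf cs]; case: m ok => [q v|q v|q v|q q' v|q v] /=.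
- case/and3P=> _ _ cv; split=> [r|r|] /=; rewrite /upd.
  + by case: eqP.
  + by case: eqP => _; rewrite ?setUS // (subset_trans (cf r)) // subsetUr.
  + by rewrite (subset_trans cs) // subsetUr.
- case/andP=> sv cv; split=> [r|r|] //=; rewrite /upd.
  + by case: eqP.
  + by case: eqP => // _; rewrite subUset sub1set (subsetP cs) // cf.
- move=> fv; split=> //=.
  by rewrite subUset sub1set (subsetP (cf q)).
- case/and3P=> fv _ cv; split=> [r|r|] //=; rewrite /upd.
  + by case: eqP.
  + by case: eqP => // _; rewrite subUset sub1set (subsetP (cf q)) // cf.
- move=> fv; split=> [r|r|] //=; rewrite /upd; case: eqP => // _.
  + by rewrite (leq_trans _ (cM q)) // subset_leq_card // subD1set.
  + by rewrite (subset_trans _ (cf q)) // subD1set.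
Qed.

Lemma coherent_run s ms : valid_run E M s ms -> coherent s -> coherent (run s ms).
Proof.
by elim: ms s => [|m ms IH] s //= [ok va] /(coherent_move ok); apply: IH.
Qed.

Lemma mem_evaluated_run s ms v :
  (v \in evaluated (run s ms)) =
  (v \in evaluated s) || (v \in [seq x.2 | x <- computes ms]).
Proof.
elim: ms s => [|m ms IH] s /=; first by rewrite orbF.
by rewrite IH; case: m => //= q w; rewrite !inE orbCA orbA.
Qed.

Lemma computes_uniq s ms : valid_run E M s ms ->
  uniq [seq x.2 | x <- computes ms] /\
  {in [seq x.2 | x <- computes ms], forall v, v \notin evaluated s}.
Proof.
elim: ms s => [|m ms IH] s //= [ok /IH[un fr]].
case: m ok fr => //= q v /and3P[nev _ _] fr; split.
  by rewrite un andbT; apply/negP => /fr; rewrite !inE eqxx.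
by move=> w; rewrite inE => /predU1P[->//|/fr]; rewrite !inE negb_or => /andP[].
Qed.

(** The memory of [q] grows only by computing, loading or receiving, and each of these leaves its
    mark in [computes] or [ins]. *)
Lemma operand_fast s ms q u v : valid_run E M s ms -> E u v ->
  (q, v) \in computes ms ->
  [|| u \in fast s q, u \in ins q ms | (q, u) \in computes ms].
Proof.
move=> va Euv; elim: ms s va => [|m ms IH] s //= [ok /IH{}IH].
case: m ok IH => [r w|r w|r w|r r' w|r w] /=; rewrite /upd.
- rewrite !inE !xpair_eqE => /and3P[_ /forallP ops _] IH.
  case/orP=> [/andP[/eqP-> /eqP vw]|/IH{IH}].
    by have:= ops u; rewrite -vw Euv /= => ->.
  case: eqP => [->|_]; rewrite ?inE /=.
    by case/or3P=> [/predU1P[->|->]|->|->]; rewrite ?eqxx ?orbT.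
  by case/or3P=> ->; rewrite ?orbT.
- move=> _ IH /IH{IH}; rewrite (eq_sym r); case: eqP => [->|_] //=; rewrite !inE.
  by case/or3P=> [/predU1P[->|->]|->|->]; rewrite ?eqxx ?orbT.
- by move=> _ IH /IH.
- move=> _ IH /IH{IH}; rewrite (eq_sym r'); case: eqP => [->|_] //=; rewrite !inE.
  by case/or3P=> [/predU1P[->|->]|->|->]; rewrite ?eqxx ?orbT.
- move=> _ IH /IH{IH}; case: eqP => [->|_] //=; rewrite !inE.
  by case/or3P=> [/andP[_ ->]|->|->]; rewrite ?orbT.
Qed.

(** An operand sits in fast memory when used, so it is evaluated by coherence. This excludes
    consumers computed before the segment that computes [u]. *)
Lemma operand_evaluated s ms u v : coherent s -> valid_run E M s ms -> E u v ->
  v \in [seq x.2 | x <- computes ms] -> u \in evaluated (run s ms).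
Proof.
move=> co va Euv; rewrite mem_evaluated_run.
elim: ms s co va => [|m ms IH] s //= co [ok va].
have := IH _ (coherent_move ok co) va; case: m ok {va} => //= q w.
rewrite !inE => /and3P[_ /forallP ops _] {}IH /predU1P[vw|/IH].
  have := ops u; rewrite -vw Euv /= => uq.
  by case: co => _ cf _; rewrite (subsetP (cf q)).
by rewrite orbCA orbA.
Qed.

(** A move that puts [u] elsewhere is an output by [q], a computation by another processor, or needs
    a copy elsewhere already. Whoever computes a successor of [u] holds [u], hence is [q]. *)
Lemma confined_run s ms q u : valid_run E M s ms -> confined q u s ->
  u \notin outs q ms -> (forall r, (r, u) \in computes ms -> r = q) ->
  confined q u (run s ms) /\
  forall r v, (r, v) \in computes ms -> E u v -> r = q.
Proof.
elim: ms s => [|m ms IH] s //= [ok /IH{}IH] [ns nf] no nc.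
have step : confined q u (move_eff s m).
  case: m ok no nc {IH} => [r w|r w|r w|r r' w|r w] /=.
  - move=> _ _ nc; split=> //= r'; rewrite /upd.
    case: eqP => [->|_]; last exact: nf.
    rewrite !inE => /predU1P[uw|]; last exact: nf.
    by apply: nc; rewrite inE uw eqxx.
  - case/andP=> ws _ _ _; split=> //= r'; rewrite /upd.
    case: eqP => [->|_]; last exact: nf.
    rewrite !inE => /predU1P[uw|]; last exact: nf.
    by rewrite uw ws in ns.
  - move=> wr no _; split=> //=; rewrite !inE negb_or ns andbT.
    apply/eqP => uw; rewrite -uw in wr no.
    by rewrite (nf _ wr) eqxx inE eqxx in no.
  - case/and3P=> wr _ _ no _; split=> //= r0; rewrite /upd.
    case: eqP => [->|_]; last exact: nf.
    rewrite !inE => /predU1P[uw|]; last exact: nf.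
    by rewrite -uw in wr no; rewrite (nf _ wr) eqxx inE eqxx in no.
  - move=> _ _ _; split=> //= r0; rewrite /upd.
    case: eqP => [->|_]; last exact: nf.
    by rewrite !inE => /andP[_]; apply: nf.
have nc' r : (r, u) \in computes ms -> r = q.
  by move=> ru; apply: nc; case: (m) => //= *; rewrite inE ru orbT.
have no' : u \notin outs q ms.
  apply: contra no; case: (m) => [r w|r w|r w|r r' w|r w] //=.
    by case: (r == q) => //=; rewrite inE => ->; rewrite orbT.
  by case: (r == q) => //=; rewrite inE => ->; rewrite orbT.
have [cr only] := IH step no' nc'; split=> // r v.
case: m ok {IH step cr no nc} => [r' w|??|??|???|??] //=; try by move=> _; apply: only.
case/and3P=> _ /forallP ops _; rewrite inE xpair_eqE => /orP[|]; last exact: only.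
case/andP=> /eqP-> /eqP-> Euw; apply: nf.
by have := ops u; rewrite Euw.
Qed.

(** A value with no copy left is gone for good: loading, storing and sending need a copy, and
    computing it again is forbidden. *)
Lemma lost_run s ms u v : valid_run E M s ms ->
  u \in evaluated s -> u \notin slow s -> (forall r, u \notin fast s r) ->
  E u v -> v \notin [seq x.2 | x <- computes ms].
Proof.
move=> va eu su fu Euv; elim: ms s va eu su fu => [|m ms IH] s //= [ok va] eu su fu.
have := IH _ va; case: m ok {va IH} => [r w|r w|r w|r r' w|r w] /=.
- case/and3P=> nw /forallP ops _ IH.
  have nvw : v != w.
    by apply/eqP => vw; have := ops u; rewrite -vw Euv (negPf (fu r)).
  rewrite inE negb_or nvw; apply: IH; rewrite ?inE ?eu ?orbT // => r'.
  rewrite /upd; case: eqP => // _; rewrite !inE negb_or fu andbT.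
  by apply: contraNneq nw => <-.
- case/andP=> ws _; apply=> // r'; rewrite /upd; case: eqP => // _.
  by rewrite !inE negb_or fu andbT; apply: contraNneq su => ->.
- move=> wr; apply=> //; rewrite !inE negb_or su andbT.
  by apply: contraTneq wr => <-; apply: fu.
- case/and3P=> wr _ _; apply=> // r0; rewrite /upd; case: eqP => // _.
  by rewrite !inE negb_or fu andbT; apply: contraTneq wr => <-.
- move=> _; apply=> // r0; rewrite /upd; case: eqP => // _.
  by rewrite !inE negb_and fu orbT.
Qed.

(** * Boundary of a segment against its I/O *)

Definition in_boundary (S : {set 'I_n}) :=
  [set u | (u \notin S) && [exists v in S, E u v]].
Definition out_boundary (S : {set 'I_n}) :=
  [set u in S | [exists v, (v \notin S) && E u v]].

Lemma segment_io q (pre seg post : seq (move n p)) (S := [set:: computed_by q seg]) :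
  parallel_evaluation E M (pre ++ seg ++ post) ->
  #|in_boundary S| + #|out_boundary S| <= io q seg + 2 * M.
Proof.
case; set s := init_state n p; rewrite -/(run s _) => va.
have [un _] := computes_uniq va.
move: (va) => /valid_run_cat[vpre /valid_run_cat[vseg vpost]] fin.
set s0 := run s pre in vseg vpost; set s1 := run s0 seg in vpost.
have co0 : coherent s0 := coherent_run vpre coherent_init.
have co1 : coherent s1 := coherent_run vseg co0.
have cardlist (A : {set 'I_n}) (l : seq 'I_n) r s' : coherent s' ->
    A \subset fast s' r :|: [set:: l] -> #|A| <= M + size l.
  case=> cM _ _ /subset_leq_card /leq_trans; apply.
  apply: leq_trans (leq_card_setU _ _) _; apply: leq_add; first exact: cM.
  by rewrite cardsE card_size.
have inB : #|in_boundary S| <= M + size (ins q seg).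
  apply: (cardlist _ _ q s0) => //; apply/subsetP=> u; rewrite !inE.
  rewrite mem_computed_by => /andP[nu /existsP[v]].
  rewrite inE mem_computed_by => /andP[qv Euv].
  by have := operand_fast vseg Euv qv; rewrite (negPf nu) orbF.
have outB : #|out_boundary S| <= M + size (outs q seg).
  apply: (cardlist _ _ q s1) => //; apply/subsetP=> u; rewrite !inE.
  rewrite mem_computed_by => /andP[qu /existsP[v]].
  rewrite inE mem_computed_by => /andP[nqv Euv].
  case: (boolP (u \in outs q seg)) => [|no]; rewrite ?orbT // orbF.
  have useg : u \in [seq x.2 | x <- computes seg] by apply/mapP; exists (q, u).
  have nev : u \notin evaluated s0 by have [_] := computes_uniq vseg; apply.
  have cu0 : confined q u s0.
    case: co0 => _ cf cs; split; first by apply: contra nev; apply: subsetP cs _.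
    by move=> r /(subsetP (cf r)); rewrite (negPf nev).
  (* No vertex is computed twice, so the pairs [(r, u)] and [(q, u)] have the same index in
     [computes seg]. *)
  have onlyq r : (r, u) \in computes seg -> r = q.
    move=> ru; have := un; rewrite !computes_cat !map_cat cat_uniq => /and3P[_ _].
    rewrite cat_uniq => /andP[+ _] => /(uniqP u).
    move: ru qu; set l := computes seg => ru qu /(_ (index (r, u) l) (index (q, u) l)).
    rewrite !inE size_map !index_mem => /(_ ru qu).
    rewrite !(nth_map (q, u)) ?index_mem // !nth_index //= => /(_ erefl) eqi.
    by have := nth_index (q, u) ru; rewrite eqi nth_index // => -[].
  have [[ns1 cf1] only] := confined_run vseg cu0 no onlyq.
  have : v \in evaluated (run s (pre ++ seg ++ post)) by rewrite fin inE.
  (* The consumer [v] cannot precede the segment, as [u] would be evaluated too early; inside it,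
     [v] would be computed by [q]. So [v] comes later, and [u], never sent out, must have survived
     in the memory of [q]. *)
  rewrite mem_evaluated_run inE /= !computes_cat !map_cat !mem_cat => /or3P[vp|vp|vp].
  - by rewrite (operand_evaluated coherent_init vpre Euv vp) in nev.
  - case/mapP: vp => -[r w] rw /= vw; rewrite -vw in rw.
    by rewrite -(only r v rw Euv) rw in nqv.
  - apply: contraTT vp => nuq; apply: (lost_run vpost _ ns1) => //.
      by rewrite mem_evaluated_run useg orbT.
    by move=> r; apply/negP => ur; rewrite -(cf1 r ur) ur in nuq.
rewrite io_ins_outs mul2n -addnn addnACA ![_ + M]addnC.
exact: leq_add.
Qed.

(** * Choosing a processor and cutting the run *)

Lemma busiest_processor ms : (0 < p) ->
  exists q, size (computes ms) <= p * size (computed_by q ms).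
Proof.
move=> p0.
pose q := [arg max_(q > Ordinal p0) size (computed_by q ms)].
exists q; rewrite /q; case: arg_maxnP => // q1 _ qmax.
have -> : size (computes ms) = \sum_(r < p) size (computed_by r ms).
  under eq_bigr do rewrite /computed_by size_map size_filter -sum1_count.
  rewrite (exchange_big_dep predT) //= -sum1_size; apply: eq_bigr => x _.
  by rewrite (big_pred1 x.1).
by rewrite -[X in X * _]card_ord -sum_nat_const leq_sum // => r _; apply: qmax.
Qed.

Lemma split_computes q b k ms : k * b <= size (computed_by q ms) ->
  exists segs rest, [/\ ms = flatten segs ++ rest, size segs = k &
    all (fun sg => size (computed_by q sg) == b) segs].
Proof.
elim: k ms => [|k IH] ms; first by exists [::], ms.
(* Discrete intermediate values: one move raises the count of vertices computed by [q] by at most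
   one, so some prefix reaches exactly [c]. *)
have prefix c l : c <= size (computed_by q l) ->
    exists l1 l2, l = l1 ++ l2 /\ size (computed_by q l1) = c.
  elim: l c => [|m l IHl] [|c]; try by [exists [::], [::] | exists [::], (m :: l)].
  rewrite -cat1s computed_by_cat size_cat.
  case E1 : (size (computed_by q [:: m])) => [|[|z]].
  - move=> /IHl[l1 [l2 [-> sz]]]; exists (m :: l1), l2; split=> //.
    by rewrite -cat1s computed_by_cat size_cat E1.
  - move=> /IHl[l1 [l2 [-> sz]]]; exists (m :: l1), l2; split=> //.
    by rewrite -cat1s computed_by_cat size_cat E1 sz.
  - by move: E1; case: (m) => //= r v; rewrite /computed_by /=; case: eqP.
rewrite mulSn => le; have [l1 [l2 [ml sz]]] := prefix b ms (leq_trans (leq_addr _ _) le).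
move: le; rewrite ml computed_by_cat size_cat sz leq_add2l => /IH[segs [rest [-> szs al]]].
by exists (l1 :: segs), rest; rewrite /= catA szs sz eqxx.
Qed.

End Runs.

(** * Spectral tools and Ky Fan's inequality *)

Local Open Scope ring_scope.

Lemma char_poly_similar (F : comUnitRingType) n (P A : 'M[F]_n) :
  P \in unitmx -> char_poly (invmx P *m A *m P) = char_poly A.
Proof.
move=> uP; rewrite /char_poly /char_poly_mx.
have -> : 'X%:M - map_mx polyC (invmx P *m A *m P) =
    map_mx polyC (invmx P) *m ('X%:M - map_mx polyC A) *m map_mx polyC P.
  rewrite !map_mxM mulmxBr mulmxBl; congr (_ - _).
  by rewrite mul_mx_scalar -scalemxAl -map_mxM mulVmx // map_mx1 scalemx1.
rewrite !det_mulmx mulrAC -det_mulmx -map_mxM mulVmx // map_mx1 det1.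
by rewrite mul1r.
Qed.

(** Cauchy-Schwarz against the constant 1, from expanding a double sum of squares. Stated over a
    [numDomainType] with real values so that it applies to moduli in [R[i]]. *)
Lemma sqr_sum_le (F : numDomainType) (I : finType) (S : {set I}) (a : I -> F) :
  (forall i, a i \is Num.real) ->
  (\sum_(i in S) a i) ^+ 2 <= #|S|%:R * \sum_(i in S) a i ^+ 2.
Proof.
move=> ra.
have : 0 <= \sum_(i in S) \sum_(j in S) (a i - a j) ^+ 2.
  by do 2![apply: sumr_ge0 => ? _]; rewrite real_exprn_even_ge0 // realB.
have -> : \sum_(i in S) \sum_(j in S) (a i - a j) ^+ 2 =
    (#|S|%:R * (\sum_(i in S) a i ^+ 2) - (\sum_(i in S) a i) ^+ 2) *+ 2.
  have -> : \sum_(i in S) \sum_(j in S) (a i - a j) ^+ 2 =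
      \sum_(i in S) \sum_(j in S) ((a i ^+ 2 + a j ^+ 2) - (a i * a j) *+ 2).
    by do 2![apply: eq_bigr => ? _]; rewrite sqrrB addrAC.
  under eq_bigr do rewrite sumrB big_split /= sumr_const sumrMnl -mulr_sumr.
  rewrite sumrB big_split /= sumrMnl sumr_const sumrMnl -mulr_suml -expr2.
  by rewrite -mulr2n -mulrnBl mulr_natl.
by rewrite pmulrn_lge0 // subr_ge0.
Qed.

(** The linear programme behind Ky Fan: weights in [0,1] of total [k] do best when concentrated on
    the [k] smallest values. *)
Lemma sum_smallest_le (R : realDomainType) n k (lam : seq R) (d c : 'I_n -> R) :
  size lam = n -> sorted <=%R lam -> perm_eq [seq d i | i <- enum 'I_n] lam ->
  (0 < k <= n)%N -> (forall i, 0 <= c i <= 1) -> \sum_i c i = k%:R ->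
  \sum_(i < k) lam`_i <= \sum_i d i * c i.
Proof.
move=> sz srt pe /andP[k0 kn] c01 ck.
(* Comparing with the threshold [t] makes the bound symmetric in the [d i]. *)
set t := lam`_(k.-1); pose g x := Num.min (x - t) 0.
have le_g i : g (d i) + t * c i <= d i * c i.
  rewrite -lerBrDr -mulrBl /g; have /andP[c0 c1] := c01 i.
  case: (lerP (d i - t) 0) => h; last by rewrite mulr_ge0 // ltW.
  by rewrite -subr_ge0 -[X in _ - X]mulr1 -mulrBr mulr_le0 // subr_le0.
apply: le_trans (ler_sum _ (fun i _ => le_g i)).
rewrite big_split /= -mulr_sumr ck.
have -> : \sum_i g (d i) = \sum_(x <- lam) g x.
  by rewrite -(perm_big _ pe) /= big_map big_enum.
rewrite (big_nth 0) sz (big_cat_nat (n := k)) //=.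
have srtP i j : (i <= j)%N -> (j < n)%N -> lam`_i <= lam`_j.
  by move=> ij jn; apply: le_sorted_leq_nth => //; rewrite inE sz // (leq_ltn_trans ij).
(* Past the first [k] entries [lam] is at least [t] and [g] vanishes; before, [g x = x - t], and the
   shifts cancel against [t * k]. *)
rewrite [X in (_ + X) + _]big_nat_cond [X in (_ + X) + _]big1 ?addr0; last first.
  move=> i; rewrite andbT => /andP[ki iN]; apply/min_idPr; rewrite subr_ge0 srtP //.
  by rewrite (leq_trans (leq_pred _)).
rewrite big_mkord [X in _ <= X + _](eq_bigr (fun i : 'I_k => lam`_i - t)); last first.
  move=> i _; apply/min_idPl; rewrite subr_le0 srtP //; last by rewrite prednK.
  by rewrite -ltnS prednK.
by rewrite sumrB sumr_const card_ord mulr_natr subrK.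
Qed.

(** Unitary diagonalisation over [R[i]]. The diagonal and the image of [lam] are root lists of the
    same characteristic polynomial, so they agree up to order and the diagonal is real. *)
Lemma symmetric_spectral (R : rcfType) n (A : 'M[R]_n) (lam : seq R) :
  A^T = A -> char_poly A = \prod_(x <- lam) ('X - x%:P) ->
  exists (P : 'M[R[i]]_n) (d : 'I_n -> R),
  [/\ P \is unitarymx, perm_eq [seq d i | i <- enum 'I_n] lam &
      forall u v, real_complex R (A u v) =
                  \sum_i real_complex R (d i) * ((P i u)^* * P i v)].
Proof.
move=> symA chA; set f := real_complex R; set AC := map_mx f A.
have hAC : AC \is hermsymmx.
  apply: realsym_hermsym.
    by apply/is_hermitianmxP; rewrite expr0 scale1r map_mx_id // map_trmx symA.
  by apply/mxOverP => i j; rewrite mxE; apply/complex_realP; exists (A i j).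
have /orthomx_spectralP := hermitian_normalmx hAC.
have := spectral_unitarymx AC.
set P := spectralmx AC; set D := spectral_diag AC => uP eA.
have pe : perm_eq [seq D 0 i | i <- enum 'I_n] [seq f x | x <- lam].
  apply: prod_XsubC_eq; rewrite big_map big_enum big_map /=.
  have -> : \prod_i ('X - (D 0 i)%:P) = char_poly AC.
    rewrite eA char_poly_similar ?unitarymx_unit // char_poly_trig ?diag_mx_is_trig //.
    by apply: eq_bigr => i _; rewrite mxE eqxx mulr1n.
  rewrite -map_char_poly chA rmorph_prod; apply: eq_bigr => x _ /=.
  by rewrite rmorphB /= map_polyX map_polyC.
have reD i : f (complex.Re (D 0 i)) = D 0 i.
  have : D 0 i \in [seq D 0 i | i <- enum 'I_n] by rewrite map_f // mem_enum.
  by rewrite (perm_mem pe) => /mapP[x _ ->].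
exists P, (fun i => complex.Re (D 0 i)); split=> //.
  have := perm_map (@complex.Re R) pe; rewrite -!map_comp => /perm_trans; apply.
  by rewrite (eq_map (g := id)) ?map_id.
move=> u v; have -> : f (A u v) = AC u v by rewrite mxE.
rewrite eA invmx_unitary // -mulmxA mxE; apply: eq_bigr => i _.
rewrite mul_diag_mx !mxE reD; ring.
Qed.

(** In the eigenbasis the normalised quadratic forms of the indicators sum to the [d i] weighted by
    [c i], to which [sum_smallest_le] applies. *)
Lemma sum_eigenvalues_le (R : rcfType) n k (A : 'M[R]_n) (lam : seq R)
    (S : 'I_k -> {set 'I_n}) :
  A^T = A -> size lam = n -> sorted <=%R lam ->
  char_poly A = \prod_(x <- lam) ('X - x%:P) -> (0 < k <= n)%N ->
  (forall j, S j != set0) -> (forall i j, i != j -> [disjoint S i & S j]) ->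
  \sum_(i < k) lam`_i <=
  \sum_j (\sum_(u in S j) \sum_(v in S j) A u v) / #|S j|%:R.
Proof.
move=> symA sz srt chA kn neS djS.
have [P [d [uP pe eA]]] := symmetric_spectral symA chA.
(* Squared modulus of the [i]-th coordinate of the indicator of [S j] in the eigenbasis. *)
pose W i j : R[i] := `|\sum_(u in S j) P i u| ^+ 2.
(* Used with [e = 1] for the total weight [k] and with [e = d] for the quadratic forms of [A]. *)
have WE (e : 'I_n -> R[i]) j : \sum_i e i * W i j =
    \sum_(u in S j) \sum_(v in S j) \sum_i e i * ((P i u)^* * P i v).
  under [RHS]eq_bigr do rewrite exchange_big /=.
  rewrite [RHS]exchange_big /=; apply: eq_bigr => i _.
  rewrite /W normCK [_ * _^*]mulrC rmorph_sum mulr_suml mulr_sumr /=.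
  by apply: eq_bigr => u _; rewrite !mulr_sumr.
have col1 u v : \sum_i (P i u)^* * P i v = (u == v)%:R.
  have /mulmx1C /matrixP /(_ u v) := unitarymxP uP; rewrite !mxE => <-.
  by apply: eq_bigr => i _; rewrite !mxE.
have row1 i : \sum_u `|P i u| ^+ 2 = 1.
  have /matrixP /(_ i i) := unitarymxP uP; rewrite !mxE eqxx; apply: etrans.
  by apply: eq_bigr => u _; rewrite !mxE normCK.
have S0 j : (0 : R[i]) < #|S j|%:R by rewrite ltr0n card_gt0.
pose cC i := \sum_j W i j / #|S j|%:R.
have cC0 i : 0 <= cC i.
  by apply: sumr_ge0 => j _; rewrite mulr_ge0 ?invr_ge0 ?exprn_ge0 // ltW.
(* Bessel's inequality for the normalised indicators of the [S j]. *)
have cC1 i : cC i <= 1.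
  apply: (@le_trans _ _ (\sum_j \sum_(u in S j) `|P i u| ^+ 2)).
    apply: ler_sum => j _; rewrite ler_pdivrMr // mulrC.
    apply: le_trans (sqr_sum_le _ _); last by move=> u; apply: normr_real.
    by rewrite lerXn2r ?nnegrE ?sumr_ge0 // ler_norm_sum.
  rewrite -(row1 i) (exchange_big_dep predT) //=; apply: ler_sum => u _.
  rewrite sumr_const -mulr_natl ler_piMl ?exprn_ge0 // lern1 leqNgt.
  apply/negP => /card_gt1P[i1 [i2 [h1 h2 ne]]].
  have := djS i1 i2 ne; rewrite disjoints_subset => /subsetP/(_ u h1).
  by rewrite inE => /negP; apply.
have reC i : real_complex R (complex.Re (cC i)) = cC i by rewrite RRe_real // ger0_real.
pose c i := complex.Re (cC i).
have scC : \sum_i cC i = k%:R.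
  rewrite /cC exchange_big /= -[k in RHS]card_ord -sum1_card natr_sum.
  apply: eq_bigr => j _; rewrite -mulr_suml.
  under eq_bigr do rewrite -[W _ _]mul1r.
  rewrite WE; under eq_bigr do under eq_bigr do (under eq_bigr do rewrite mul1r); rewrite /=.
  have -> : \sum_(u in S j) \sum_(v in S j) (\sum_i (P i u)^* * P i v) = #|S j|%:R.
    rewrite -sum1_card natr_sum; apply: eq_bigr => u uS.
    rewrite (bigD1 u) //= col1 eqxx big1 ?addr0 // => v /andP[_ /negPf vu].
    by rewrite col1 eq_sym vu.
  by rewrite divff // gt_eqF.
have sdcC : \sum_i real_complex R (d i) * cC i =
    real_complex R (\sum_j (\sum_(u in S j) \sum_(v in S j) A u v) / #|S j|%:R).
  rewrite rmorph_sum; under eq_bigr do rewrite mulr_sumr.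
  rewrite exchange_big /=; apply: eq_bigr => j _.
  under eq_bigr do rewrite mulrA.
  rewrite -mulr_suml WE rmorphM fmorphV rmorph_nat; congr (_ / _).
  rewrite rmorph_sum; apply: eq_bigr => u _; rewrite rmorph_sum.
  by apply: eq_bigr => v _; rewrite /= eA.
have -> : \sum_j (\sum_(u in S j) \sum_(v in S j) A u v) / #|S j|%:R = \sum_i d i * c i.
  apply: (@complexI R); rewrite -sdcC rmorph_sum; apply: eq_bigr => i _.
  by rewrite rmorphM /= reC.
apply: sum_smallest_le => //.
  by move=> i; rewrite -!lecR reC cC0 cC1.
by apply: (@complexI R); rewrite rmorph_sum rmorph_nat -scC; apply: eq_bigr => i _; exact: reC.
Qed.

(** * The Laplacian and weighted cuts *)

Section Laplacian.
Variables (R : realFieldType) (n : nat) (E : rel 'I_n).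

Lemma laplacian_sym : (laplacian R E)^T = laplacian R E.
Proof.
apply/matrixP => u v; rewrite !mxE eq_sym [X in _ - X]addrC; congr (_ - _).
by case: eqP => [->|].
Qed.

(** Row [u] sums over [S] to the full weighted degree of [u] minus its weights inside [S], which
    leaves the weights crossing to the complement. *)
Lemma laplacian_cut (S : {set 'I_n}) :
  \sum_(u in S) \sum_(v in S) laplacian R E u v =
  \sum_(u in S) \sum_(v | v \notin S) wadj R E u v.
Proof.
apply: eq_bigr => u uS.
have -> : \sum_(v in S) laplacian R E u v =
    \sum_v wadj R E u v - \sum_(v in S) wadj R E u v.
  under eq_bigr do rewrite mxE [X in _ + X]mxE.
  rewrite sumrB; congr (_ - _); rewrite (bigD1 u) //= big1 ?addr0.
    by rewrite !mxE eqxx.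
  by move=> v /andP[_ /negPf vu]; rewrite !mxE eq_sym vu.
by rewrite [X in X - _](bigID (mem S)) /= addrAC subrr add0r.
Qed.

(** The edges out of [u], if any, share total weight 1. The bound is an indicator so that a sum over
    [u] counts boundary vertices. *)
Lemma out_weight_le (u : 'I_n) (Q : pred 'I_n) :
  \sum_(v | Q v) (E u v)%:R / (dout E u)%:R <= [exists v, Q v && E u v]%:R :> R.
Proof.
case: (boolP [exists v, Q v && E u v]) => [/existsP[w /andP[_ Euw]]|/existsPn none].
  have d0 : (0 : R) < (dout E u)%:R.
    by rewrite ltr0n card_gt0; apply/set0Pn; exists w; rewrite inE.
  rewrite -mulr_suml ler_pdivrMr // mul1r -natr_sum ler_nat /dout -sum1_card.
  rewrite big_mkcond [X in (_ <= X)%N]big_mkcond leq_sum // => v _.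
  by rewrite inE; case: (Q v); case: (E u v).
rewrite big1 // => v Qv; have := none v; rewrite Qv /= => /negPf->.
by rewrite mul0r.
Qed.

End Laplacian.

(** Each crossing edge is charged to its tail, which fixes its weight: an edge leaving [S] to the
    out-boundary, an edge entering [S] to the in-boundary. *)
Lemma cut_le_boundary (R : realFieldType) n (E : rel 'I_n) (S : {set 'I_n}) :
  \sum_(u in S) \sum_(v | v \notin S) wadj R E u v <=
  (#|in_boundary E S| + #|out_boundary E S|)%:R.
Proof.
under eq_bigr do (under eq_bigr do rewrite mxE); rewrite /=.
under eq_bigr do rewrite big_split /=.
rewrite big_split /= addrC natrD; apply: lerD.
  rewrite exchange_big /= -sum1_card natr_sum.
  rewrite [leRHS](eq_bigl (fun u => (u \notin S) && [exists v in S, E u v])); last first.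
    by move=> u; rewrite inE.
  rewrite big_mkcondr /=; apply: ler_sum => u _.
  by apply: le_trans (out_weight_le _ _ _ _) _; case: ifP.
rewrite -sum1_card natr_sum.
rewrite [leRHS](eq_bigl
  (fun u => (u \in S) && [exists v, (v \notin S) && E u v])); last first.
  by move=> u; rewrite inE.
rewrite big_mkcondr /=; apply: ler_sum => u _.
by apply: le_trans (out_weight_le _ _ _ _) _; case: ifP.
Qed.

(** * Assembling the segments *)

Lemma uniq_flatten_nth (T : eqType) (ss : seq (seq T)) i j x :
  uniq (flatten ss) -> (i < size ss)%N -> (j < size ss)%N ->
  x \in nth [::] ss i -> x \in nth [::] ss j -> i = j.
Proof.
move=> un; wlog ij : i j / (i < j)%N.
  by move=> IH; case: (ltngtP i j) => // ij si sj xi xj; [|symmetry]; apply: IH.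
move=> si sj xi xj; move: un.
rewrite -(cat_take_drop j ss) (drop_nth [::] sj) flatten_cat /= cat_uniq.
case/and3P=> _ /hasPn/(_ x) + _; rewrite mem_cat xj => /(_ isT)/negP[].
apply/flattenP; exists (nth [::] ss i) => //.
by rewrite -(nth_take [::] ij) mem_nth // size_takel // ltnW.
Qed.

Theorem theorem4p6 (R : realType) (n p M : nat) (E : rel 'I_n)
    (lam : seq R) (ms : seq (move n p)) (k : nat) :
  dag E -> (0 < p)%N ->
  size lam = n -> sorted <=%R lam ->
  char_poly (laplacian R E) = \prod_(x <- lam) ('X - x%:P) ->
  (0 < k)%N ->
  parallel_evaluation E M ms ->
  exists q : 'I_p,
    (n %/ (k * p))%:R * (\sum_(i < k) lam`_i) - (2 * k * M)%:R <= (io q ms)%:R.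
Proof.
move=> _ p0 sz srt chL k0 pev; set b := (n %/ (k * p))%N.
(* With [b = 0] the left side is nonpositive and any processor will do. Otherwise [k <= n], as Ky
   Fan's inequality requires. *)
have [b0|b0] := posnP b.
  exists (Ordinal p0); rewrite b0 mul0r add0r.
  by apply: (@le_trans _ _ 0); rewrite ?oppr_le0 ler0n.
have [q busy] := busiest_processor ms p0; exists q.
have [va fin] := pev; have [un _] := computes_uniq va.
(* All [n] vertices are computed, [q] has at least a share [1 / p] of them, and
   [p * (k * b) <= n]. *)
have kb : (k * b <= size (computed_by q ms))%N.
  rewrite -(leq_pmul2l p0) (leq_trans _ busy) // mulnA [(p * k)%N]mulnC mulnC.
  apply: leq_trans (leq_divM _ _) _.
  rewrite -(size_map snd) -[n in (n <= _)%N]card_ord -cardsT -fin.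
  apply: leq_trans (card_size _); apply/subset_leq_card/subsetP => v.
  by rewrite -/(run _ _) mem_evaluated_run inE.
have [segs [rest [ems szs al]]] := split_computes kb.
pose seg (j : 'I_k) := nth [::] segs j; pose S j := [set:: computed_by q (seg j)].
have uncb : uniq (computed_by q ms).
  apply: subseq_uniq un; exact/map_subseq/filter_subseq.
have ebf ss : computed_by q (flatten ss) = flatten [seq computed_by q s | s <- ss].
  by elim: ss => //= s ss IH; rewrite computed_by_cat IH.
have unf : uniq (flatten [seq computed_by q s | s <- segs]).
  by move: uncb; rewrite ems computed_by_cat cat_uniq ebf => /and3P[].
have js (j : 'I_k) : (j < size segs)%N by rewrite szs.
have Sflat j : computed_by q (seg j) = nth [::] [seq computed_by q s | s <- segs] j.
  by rewrite (nth_map [::]).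
have cS j : #|S j| = b.
  rewrite cardsE (card_uniqP _).
    by apply/eqP; have /all_nthP-> := al.
  move: unf; rewrite Sflat -{1}(cat_take_drop j (map _ _)) (drop_nth [::]) ?size_map //.
  by rewrite flatten_cat cat_uniq /= cat_uniq => /and3P[_ _ /andP[]].
have segio j : \sum_(u in S j) \sum_(v in S j) laplacian R E u v <=
    (io q (seg j) + 2 * M)%:R.
  rewrite laplacian_cut; apply: le_trans (cut_le_boundary _ _ _) _; rewrite ler_nat.
  apply: (@segment_io _ _ _ _ _ (flatten (take j segs)) _
                      (flatten (drop j.+1 segs) ++ rest)).
  rewrite [_ ++ _ ++ _](_ : _ = ms) // ems -[in RHS](cat_take_drop j segs).
  by rewrite (drop_nth [::] (js j)) flatten_cat /= -!catA.
have kyfan : \sum_(i < k) lam`_i <=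
    \sum_j (\sum_(u in S j) \sum_(v in S j) laplacian R E u v) / #|S j|%:R.
  apply: sum_eigenvalues_le => //; first exact: laplacian_sym.
  - rewrite k0 /= (leq_trans (leq_pmulr k p0)) //.
    by move: b0; rewrite /b divn_gt0 ?muln_gt0 ?k0.
  - by move=> j; rewrite -card_gt0 cS.
  - move=> i j ij; rewrite -setI_eq0; apply/eqP/setP => v; rewrite !inE !Sflat.
    apply/negP => /andP[vi vj]; move/eqP: ij; apply; apply: val_inj.
    by apply: uniq_flatten_nth unf _ _ vi vj; rewrite size_map.
have b0R : (0 : R) < b%:R by rewrite ltr0n.
have {}kyfan : b%:R * (\sum_(i < k) lam`_i) <= \sum_j (io q (seg j) + 2 * M)%:R.
  rewrite mulrC -ler_pdivlMr // mulr_suml (le_trans kyfan) //; apply: ler_sum => j _.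
  by rewrite cS ler_pM2r ?invr_gt0.
(* The [k] allowances of [2 * M] add up to [2 * k * M]; the I/O of [q] in [rest] only helps. *)
rewrite lerBlDr (le_trans kyfan) // -natr_sum -natrD ler_nat big_split /=.
rewrite sum_nat_const card_ord mulnCA mulnA leq_add2r ems io_cat.
apply: leq_trans (leq_addr _ _).
have -> : io q (flatten segs) = \sum_(s <- segs) io q s.
  elim: (segs) => [|s ss IH]; first by rewrite /io !big_nil.
  by rewrite big_cons /= io_cat IH.
by rewrite (big_nth [::]) szs big_mkord.
Qed.
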